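(* Let $K$ be a field of characteristic $2$, and for $n\ge1$ let $$F_n=(X_1+X_2^2,\,X_2+X_3^2,\,\dots,\,X_{n-1}+X_n^2,\,X_n)\in\mathrm{GA}_n(K).$$ Then $F_n$ is unitriangular, hence Pascal finite, and $|F_n|=2^{\lceil\log_2 n\rceil}$. In particular, for $n=2^{r-1}+1$ the order of $F_n$ is $2^{r}$, with $r\ge1$ an arbitrary integer.
   Context: $K[X]=K[X_1,\dots,X_n]$. $\mathrm{GA}_n(K)$ is the group of polynomial automorphisms of affine $n$-space over $K$: an element is a tuple $F=(F_1,\dots,F_n)\in K[X]^n$ that has a two-sided inverse in $K[X]^n$ under the composition $(F\circ G)_i=F_i\circ G=F_i(G_1,\dots,G_n)$; the identity is $\mathrm{Id}=(X_1,\dots,X_n)$. $|F|$ denotes the order of $F$ in this group. $F$ is unitriangular if $F_i=X_i+q_i$ with $q_i\in K[X_{i+1},\dots,X_n]$ for every $i$ (so $q_n\in K$). For $F\in K[X]^n$ let $\sigma_F\colon K[X]\to K[X]$, $\sigma_F(P)=P\circ F=P(F_1,\dots,F_n)$, and $\Delta_F=\sigma_F-\mathrm{Id}$, i.e. $\Delta_F(P)=P\circ F-P$. For $g\in K[X]$ put $\tau_K^F(g)=\min\{m\ge1:\Delta_F^m(g)=0\}$, with value $\infty$ if no such $m$ exists, and $\tau_K(F)=\max_{1\le i\le n}\tau_K^F(X_i)$ (the Pascal depth of $F$). $F$ is called Pascal finite if $\tau_K(F)<\infty$. *)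

(* Defs.v *)
From Stdlib Require Import ClassicalEpsilon.
From mathcomp Require Import all_boot all_order all_algebra.
From mathcomp Require Import mpoly.

Set Implicit Arguments.
Unset Strict Implicit.
Unset Printing Implicit Defensive.

Import GRing.Theory.
Local Open Scope ring_scope.

(* Values in {0, 1, 2, ...} with infinity are rendered in [option nat], where
   [None] is infinity. *)

Definition least_pos (P : pred nat) : option nat :=
  match excluded_middle_informative (exists m, (0 < m)%N && P m) with
  | left exP => Some (ex_minn exP)
  | right _ => None
  end.

Definition omaxn (a b : option nat) : option nat :=
  if a is Some k then (if b is Some l then Some (maxn k l) else None)
  else None.

Section PolynomialMaps.
Variables (K : fieldType) (n : nat).

(* Coordinates are numbered from 0: [tnth F i] is the (i + 1)-st component
   and 'X_i the (i + 1)-st variable. *)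
Definition polymap := n.-tuple {mpoly K[n]}.

Definition pm_id : polymap := [tuple 'X_i | i < n].

Definition pm_comp (F G : polymap) : polymap :=
  [tuple tnth F i \mPo G | i < n].

Definition in_GA (F : polymap) : Prop :=
  exists G : polymap, pm_comp F G = pm_id /\ pm_comp G F = pm_id.

(* For F in GA_n(K) this is the m-th power of F in that group. *)
Definition pm_pow (F : polymap) (m : nat) : polymap :=
  iter m (pm_comp F) pm_id.

Definition pm_order (F : polymap) : option nat :=
  least_pos (fun m => pm_pow F m == pm_id).

(* q is a polynomial in the variables 'X_j with i < j. *)
Definition in_later_vars (i : 'I_n) (q : {mpoly K[n]}) : Prop :=
  forall m, m \in msupp q -> forall j : 'I_n, (j <= i)%N -> m j = 0%N.

Definition unitriangular (F : polymap) : Prop :=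
  forall i : 'I_n,
    exists q : {mpoly K[n]}, tnth F i = 'X_i + q /\ in_later_vars i q.

Definition sigma (F : polymap) (P : {mpoly K[n]}) : {mpoly K[n]} := P \mPo F.

Definition Delta (F : polymap) (P : {mpoly K[n]}) : {mpoly K[n]} :=
  sigma F P - P.

Definition tau (F : polymap) (g : {mpoly K[n]}) : option nat :=
  least_pos (fun m => iter m (Delta F) g == 0).

Definition pascal_depth (F : polymap) : option nat :=
  \big[omaxn/Some 0%N]_(i < n) tau F 'X_i.

Definition pascal_finite (F : polymap) : Prop := pascal_depth F <> None.

(* [insub i.+1 : option 'I_n] is the index following i, if there is one. *)
Definition square_shift : polymap :=
  [tuple if insub i.+1 is Some j then 'X_i + 'X_j ^+ 2 else 'X_i | i < n].

End PolynomialMaps.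

Arguments square_shift K n : clear implicits.

(* Main.v *)
Require Import Defs.
From Stdlib Require Import ClassicalEpsilon.
From mathcomp Require Import all_boot all_order all_algebra.
From mathcomp Require Import mpoly.

(** Write s for the algebra endomorphism P |-> P \o F of K[X] and D = s - 1.
    In characteristic 2, squaring is additive and commutes with s, hence with
    D.  As D sends X_i to X_(i+1)^2, or to 0 when i is the last index, it
    follows that D^k sends X_i to X_(i+k)^(2^k), or to 0 when i + k leaves the
    range ([iter_Delta_square_shift]).  In particular D^n kills every variable,
    which is Pascal finiteness.

    Characteristic 2 also gives s^(2^e) = 1 + D^(2^e)
    ([iter_sigma_pow2]), so the explicit form of D^(2^e) shows that F^(2^e) is
    the identity exactly when 2^e >= n ([square_shift_pow2]).  The least such
    power of 2 is 2^e0 with e0 the rounded up logarithm of n.  It remains to see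
    that no smaller positive exponent works: if F^k = Id, then also
    F^(gcd k 2^e0) = Id, and this gcd is a power of 2, hence at least 2^e0.
    Finally F has finite order, so one of its powers is its inverse. *)

Import GRing.Theory.
Local Open Scope ring_scope.

(** * Least exponents and periods *)

Lemma least_pos_eq (P : pred nat) (m : nat) :
  (0 < m)%N -> P m -> (forall k, (0 < k)%N -> P k -> (m <= k)%N) ->
  least_pos P = Some m.
Proof.
move=> m_gt0 Pm minP; rewrite /least_pos.
case: excluded_middle_informative => [exP | []]; last first.
  by exists m; rewrite m_gt0 Pm.
case: ex_minnP => k /andP[k_gt0 Pk] mink; congr Some; apply/eqP.
by rewrite eqn_leq mink ?m_gt0 ?Pm // minP.
Qed.

Lemma least_pos_finite (P : pred nat) (m : nat) :
  (0 < m)%N -> P m -> least_pos P <> None.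
Proof.
move=> m_gt0 Pm; rewrite /least_pos.
by case: excluded_middle_informative => // -[]; exists m; rewrite m_gt0 Pm.
Qed.

Lemma iter_period_mul (T : Type) (f : T -> T) (x : T) (a m : nat) :
  iter m f x = x -> iter (a * m) f x = x.
Proof. by move=> fx; rewrite iterM; apply: iter_fix. Qed.

(** The Bezout relation between natural numbers, a * m = b * k + gcd m k, makes
    this true of any self-map, injective or not. *)
Lemma iter_period_gcdn (T : Type) (f : T -> T) (x : T) (m k : nat) :
  (0 < m)%N -> iter m f x = x -> iter k f x = x -> iter (gcdn m k) f x = x.
Proof.
move=> m_gt0 fm fk; case: (egcdnP k m_gt0) => a b eq_ab _.
by rewrite -{1}(iter_period_mul _ f x b k fk) -iterD addnC -eq_ab
           iter_period_mul.
Qed.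

(** * Polynomial maps and their substitution endomorphisms *)

Section PolynomialMaps.
Variables (K : fieldType) (n : nat).
Implicit Types (F G : polymap K n) (P Q : {mpoly K[n]}).

Lemma sigma_var F i : sigma F 'X_i = tnth F i.
Proof. by rewrite /sigma comp_mpolyXU -tnth_nth. Qed.

Lemma comp_mpoly_pm_comp F G P : P \mPo pm_comp F G = (P \mPo F) \mPo G.
Proof.
rewrite [LHS]comp_mpolyEX (comp_mpolyEX P F) raddf_sum /=.
apply: eq_bigr => m _; rewrite comp_mpolyZ !comp_mpolyX rmorph_prod /=.
by congr (_ *: _); apply: eq_bigr => i _; rewrite rmorphXn /= tnth_mktuple.
Qed.

Lemma comp_pm_id P : P \mPo pm_id K n = P.
Proof. exact: comp_mpoly_id. Qed.

(** Composition on the left with F only substitutes in the coordinates of F,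
    so an induction on the exponent has to be carried out for all polynomials,
    of which the coordinates are the case of the variables. *)
Lemma comp_pm_pow F m P : P \mPo pm_pow F m = iter m (sigma F) P.
Proof.
elim: m P => [|m IHm] P; first exact: comp_pm_id.
by rewrite /pm_pow iterS -/(pm_pow F m) comp_mpoly_pm_comp IHm -iterSr.
Qed.

Lemma tnth_pm_pow F m i : tnth (pm_pow F m) i = iter m (sigma F) 'X_i.
Proof. by rewrite -sigma_var; apply: comp_pm_pow. Qed.

Lemma pm_pow_eq_id F m :
  pm_pow F m = pm_id K n <-> forall i, iter m (sigma F) 'X_i = 'X_i.
Proof.
split=> [Fm i | Fm]; first by rewrite -tnth_pm_pow Fm tnth_mktuple.
by apply: eq_from_tnth => i; rewrite tnth_pm_pow Fm tnth_mktuple.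
Qed.

Lemma pm_comp_pow F m : pm_comp (pm_pow F m) F = pm_pow F m.+1.
Proof.
by apply: eq_from_tnth => i; rewrite tnth_mktuple !tnth_pm_pow iterS.
Qed.

Lemma finite_order_in_GA F m :
  (0 < m)%N -> pm_pow F m = pm_id K n -> in_GA F.
Proof.
case: m => // m _ Fm; exists (pm_pow F m).
by rewrite pm_comp_pow; split.
Qed.

Lemma pm_order_eq F m :
  (0 < m)%N -> pm_pow F m = pm_id K n ->
  (forall k, (0 < k)%N -> pm_pow F k = pm_id K n -> (m <= k)%N) ->
  pm_order F = Some m.
Proof.
move=> m_gt0 Fm minm; apply: least_pos_eq => //; first exact/eqP.
by move=> k k_gt0 /eqP; apply: minm.
Qed.

Lemma nilpotent_pascal_finite F m :
  (0 < m)%N -> (forall i, iter m (Delta F) 'X_i = 0) -> pascal_finite F.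
Proof.
move=> m_gt0 nilF; rewrite /pascal_finite /pascal_depth.
elim/big_ind: _ => // [[a|] [b|] // | i _].
by apply: (@least_pos_finite _ m) => //; rewrite nilF.
Qed.

Lemma DeltaD F P Q : Delta F (P + Q) = Delta F P + Delta F Q.
Proof. by rewrite /Delta /sigma comp_mpolyD opprD addrACA. Qed.

Lemma Delta0 F : Delta F 0 = 0.
Proof. by rewrite /Delta /sigma comp_mpoly0 subrr. Qed.

Lemma iter_DeltaD F m P Q :
  iter m (Delta F) (P + Q) = iter m (Delta F) P + iter m (Delta F) Q.
Proof. by elim: m => //= m ->; rewrite DeltaD. Qed.

(** * Characteristic 2 *)

Hypothesis charK2 : 2%N \in [pchar K].

Lemma mpoly_pchar2 : 2%N \in [pchar {mpoly K[n]}].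
Proof. by rewrite pchar_lalg. Qed.

(** Passing from e to e + 1 squares 1 + D^(2^e), and the middle term of the
    square vanishes. *)
Lemma iter_sigma_pow2 F e P :
  iter (2 ^ e) (sigma F) P = P + iter (2 ^ e) (Delta F) P.
Proof.
elim: e P => [|e IHe] P; first by rewrite /= /Delta addrC subrK.
rewrite expnS mul2n -addnn !iterD !IHe iter_DeltaD.
by rewrite addrA addrK_pchar2 // mpoly_pchar2.
Qed.

Lemma Delta_square F P : Delta F (P ^+ 2) = Delta F P ^+ 2.
Proof.
rewrite /Delta /sigma rmorphXn /= !(oppr_pchar2 mpoly_pchar2).
by rewrite -!(pFrobenius_autE mpoly_pchar2) rmorphD.
Qed.

Lemma Delta_pow2 F k P : Delta F (P ^+ (2 ^ k)) = Delta F P ^+ (2 ^ k).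
Proof.
elim: k => // k IHk.
by rewrite expnSr !exprM Delta_square IHk.
Qed.

(** * The square shift *)

Lemma Delta_square_shift_var (i : 'I_n) :
  Delta (square_shift K n) 'X_i =
  if insub i.+1 is Some j then 'X_(j : 'I_n) ^+ 2 else 0.
Proof.
rewrite /Delta sigma_var tnth_mktuple.
by case: insub => [j|]; rewrite ?subrr // addrAC subrr add0r.
Qed.

Lemma iter_Delta_square_shift k (i : 'I_n) :
  iter k (Delta (square_shift K n)) 'X_i =
  if insub (i + k)%N is Some j then 'X_(j : 'I_n) ^+ (2 ^ k) else 0.
Proof.
elim: k => [|k IHk]; first by rewrite addn0 valK expr1.
rewrite iterS IHk addnS; case: (insubP _ (i + k)%N) => [j _ /= <- | ].
  rewrite Delta_pow2 Delta_square_shift_var.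
  case: insub => [l|]; first by rewrite -exprM expnS.
  by rewrite expr0n expn_eq0.
rewrite -leqNgt Delta0 => le_n; rewrite insubF //.
by apply: negbTE; rewrite -leqNgt leqW.
Qed.

Lemma square_shift_pascal_finite : (0 < n)%N -> pascal_finite (square_shift K n).
Proof.
move=> n_gt0; apply: (@nilpotent_pascal_finite _ n) => // i.
rewrite iter_Delta_square_shift insubF //.
by apply: negbTE; rewrite -leqNgt leq_addl.
Qed.

Lemma square_shift_pow2 e : (0 < n)%N ->
  pm_pow (square_shift K n) (2 ^ e) = pm_id K n <-> (n <= 2 ^ e)%N.
Proof.
move=> n_gt0; rewrite pm_pow_eq_id; split=> [Fe | le_n i]; last first.
  rewrite iter_sigma_pow2 iter_Delta_square_shift insubF ?addr0 //.
  by apply: negbTE; rewrite -leqNgt (leq_trans le_n) ?leq_addl.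
(* When 2^e < n, the first coordinate has the extra term X_(1+2^e)^(2^(2^e)). *)
rewrite leqNgt; apply/negP => lt_n; have /eqP := Fe (Ordinal n_gt0).
rewrite iter_sigma_pow2 iter_Delta_square_shift add0n insubT.
rewrite -[X in _ == X]addr0 (inj_eq (addrI _)) expf_eq0 => /andP[_ /eqP].
move/(congr1 (mcoeff U_(Ordinal lt_n))).
by rewrite mcoeffX eqxx mcoeff0 => /eqP; rewrite oner_eq0.
Qed.

Lemma square_shift_pow_up_log : (0 < n)%N ->
  pm_pow (square_shift K n) (2 ^ up_log 2 n) = pm_id K n.
Proof. by move=> n_gt0; apply/square_shift_pow2 => //; apply: up_logP. Qed.

Lemma square_shift_in_GA : (0 < n)%N -> in_GA (square_shift K n).
Proof.
move=> n_gt0; apply: finite_order_in_GA (square_shift_pow_up_log n_gt0).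
by rewrite expn_gt0.
Qed.

Lemma square_shift_order : (0 < n)%N ->
  pm_order (square_shift K n) = Some (2 ^ up_log 2 n)%N.
Proof.
move=> n_gt0; have Fe := square_shift_pow_up_log n_gt0.
apply: pm_order_eq => // [|k k_gt0 Fk]; first by rewrite expn_gt0.
have [d _ gcd_d] : exists2 d,
    (d <= up_log 2 n)%N & gcdn k (2 ^ up_log 2 n) = (2 ^ d)%N.
  by apply/dvdn_pfactor => //; apply: dvdn_gcdr.
have /square_shift_pow2-/(_ n_gt0) le_n :
    pm_pow (square_shift K n) (2 ^ d) = pm_id K n.
  rewrite -gcd_d; apply/pm_pow_eq_id => i.
  by apply: iter_period_gcdn => //; move: i; apply/pm_pow_eq_id.
apply: (@leq_trans (2 ^ d)); first by rewrite leq_exp2l // up_log_min.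
by rewrite -gcd_d dvdn_leq // dvdn_gcdl.
Qed.

End PolynomialMaps.

Lemma square_shift_unitriangular (K : fieldType) (n : nat) :
  unitriangular (square_shift K n).
Proof.
move=> i; rewrite tnth_mktuple; case: insubP => [j _ def_j | _].
  exists ('X_j ^+ 2); split=> // m; rewrite mpolyXn msuppX mem_seq1.
  move=> /eqP-> l le_li; rewrite mulmnE mnm1E -val_eqE /= def_j.
  by rewrite gtn_eqF ?ltnS.
by exists 0; rewrite addr0; split=> // m; rewrite msupp0.
Qed.

Theorem proposition3p3 (K : fieldType) (charK2 : 2%N \in [pchar K]) :
  (forall n : nat, (1 <= n)%N ->
     [/\ in_GA (square_shift K n),
         unitriangular (square_shift K n),
         pascal_finite (square_shift K n)
       & pm_order (square_shift K n) = Some (2 ^ up_log 2 n)%N])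
  /\ (forall r : nat, (1 <= r)%N ->
        pm_order (square_shift K (2 ^ (r - 1) + 1)) = Some (2 ^ r)%N).
Proof.
split=> [n n_gt0 | [|r] // _].
  split; [exact: square_shift_in_GA | exact: square_shift_unitriangular
         | exact: square_shift_pascal_finite | exact: square_shift_order].
rewrite subn1 /= addn1 square_shift_order //.
by rewrite (@up_log_eq 2 r) // ltnSn ltn_exp2l /=.
Qed.
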